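(* $F_v(2,2,2;J_4)=9$. Moreover, up to isomorphism there are exactly $3$ graphs in $\mathcal{F}_v(2,2,2;J_4;9)$; exactly $1$ of them is maximal $J_4$-free, and exactly $1$ of them is minimal (with respect to the arrowing $(2,2,2)^v$).
   Context: All graphs are finite, simple and undirected. $J_k$ denotes the complete graph $K_k$ with one edge removed. A graph $G$ is $H$-free if it contains no subgraph (not necessarily induced) isomorphic to $H$. For integers $a_1,\dots,a_r\ge 1$, $G\rightarrow(a_1,\dots,a_r)^v$ means that for every coloring of the vertices of $G$ with colors $1,\dots,r$ there is some color $i$ and a clique on $a_i$ vertices all of color $i$. The vertex Folkman number is $F_v(a_1,\dots,a_r;H)=\min\{|V(G)| : G \text{ is } H\text{-free and } G\rightarrow(a_1,\dots,a_r)^v\}$; $\mathcal{F}_v(a_1,\dots,a_r;H;n)$ is the set of $H$-free graphs on $n$ vertices with $G\rightarrow(a_1,\dots,a_r)^v$. A $J_4$-free graph is maximal $J_4$-free if adding any new edge creates a $J_4$. A graph $G$ with $G\rightarrow(a_1,\dots,a_r)^v$ is minimal if for every edge $e$, $G-e\not\rightarrow(a_1,\dots,a_r)^v$. Note $G\rightarrow(2,2,2)^v$ is equivalent to $\chi(G)\ge 4$. *)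

(* Defs.v *)
From mathcomp Require Import all_boot.

Set Implicit Arguments.
Unset Strict Implicit.
Unset Printing Implicit Defensive.

Record sgraph := SGraph {
  vertex :> finType;
  adj : rel vertex;
  adj_sym : symmetric adj;
  adj_irr : irreflexive adj }.

Definition giso (G H : sgraph) : Prop :=
  exists2 f : G -> H, bijective f & forall x y, adj (f x) (f y) = adj x y.

(* The copy of H in G need not be induced. *)
Definition has_subgraph (H G : sgraph) : Prop :=
  exists2 f : H -> G, injective f & forall x y, adj x y -> adj (f x) (f y).

Definition free (H G : sgraph) : Prop := ~ has_subgraph H G.

(* K_k without the edge {0, 1}; intended for k >= 2. *)
Definition J_adj (k : nat) : rel 'I_k :=
  fun x y => (x != y) && ~~ ((x < 2) && (y < 2)).

Lemma J_sym k : symmetric (@J_adj k).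
Proof. by move=> x y; rewrite /J_adj eq_sym andbC (andbC (x < 2)) andbC. Qed.

Lemma J_irr k : irreflexive (@J_adj k).
Proof. by move=> x; rewrite /J_adj eqxx. Qed.

Definition J (k : nat) : sgraph := SGraph (@J_sym k) (@J_irr k).

Definition clique (G : sgraph) (K : {set G}) : Prop :=
  {in K &, forall x y, x != y -> adj x y}.

(* G -> (a_1, ..., a_r)^v, with colors indexed from 0. *)
Definition arrows (G : sgraph) (r : nat) (a : r.-tuple nat) : Prop :=
  forall c : G -> 'I_r, exists i : 'I_r, exists K : {set G},
    [/\ clique K, #|K| = tnth a i & {in K, forall x, c x = i}].

Definition folkman_graph (r : nat) (a : r.-tuple nat) (H G : sgraph) : Prop :=
  free H G /\ arrows G a.

(* F_v(a_1, ..., a_r; H) = n.  The minimum is a relation because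
   the set of candidate graphs may be empty for some parameters. *)
Definition folkman_number_is (r : nat) (a : r.-tuple nat) (H : sgraph)
    (n : nat) : Prop :=
  (exists2 G : sgraph, folkman_graph a H G & #|G| = n) /\
  (forall G : sgraph, folkman_graph a H G -> n <= #|G|).

(* Membership in the set F_v(a_1, ..., a_r; H; n). *)
Definition folkman_set (r : nat) (a : r.-tuple nat) (H : sgraph) (n : nat)
    (G : sgraph) : Prop :=
  folkman_graph a H G /\ #|G| = n.

(* The conjunct u != v makes this the identity operation when x = y. *)
Definition add_adj (G : sgraph) (x y : G) : rel G :=
  fun u v => adj u v || (u != v) && ([set u; v] == [set x; y]).

Lemma add_sym (G : sgraph) (x y : G) : symmetric (add_adj x y).
Proof. by move=> u v; rewrite /add_adj adj_sym eq_sym setUC. Qed.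

Lemma add_irr (G : sgraph) (x y : G) : irreflexive (add_adj x y).
Proof. by move=> u; rewrite /add_adj adj_irr eqxx. Qed.

Definition add_edge (G : sgraph) (x y : G) : sgraph :=
  SGraph (add_sym x y) (add_irr x y).

Definition del_adj (G : sgraph) (x y : G) : rel G :=
  fun u v => adj u v && ([set u; v] != [set x; y]).

Lemma del_sym (G : sgraph) (x y : G) : symmetric (del_adj x y).
Proof. by move=> u v; rewrite /del_adj adj_sym setUC. Qed.

Lemma del_irr (G : sgraph) (x y : G) : irreflexive (del_adj x y).
Proof. by move=> u; rewrite /del_adj adj_irr. Qed.

Definition del_edge (G : sgraph) (x y : G) : sgraph :=
  SGraph (del_sym x y) (del_irr x y).

Definition maximal_free (H G : sgraph) : Prop :=
  free H G /\
  forall x y : G, x != y -> ~~ adj x y -> has_subgraph H (add_edge x y).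

Definition minimal_arrowing (r : nat) (a : r.-tuple nat) (G : sgraph) : Prop :=
  arrows G a /\ forall x y : G, adj x y -> ~ arrows (del_edge x y) a.

(* Up to isomorphism there are exactly k graphs satisfying P. *)
Definition exactly_up_to_iso (k : nat) (P : sgraph -> Prop) : Prop :=
  exists s : 'I_k -> sgraph,
    [/\ forall i, P (s i),
        forall i j, giso (s i) (s j) -> i = j
      & forall G, P G -> exists i, giso G (s i)].

(* Main.v *)
(* A graph arrows (2,2,2) iff it is not 3-colorable.  In a graph with at most
   nine vertices which is J_4-free and not 3-colorable, take a smallest set of
   vertices inducing a non-3-colorable subgraph: there all degrees are at least
   3.  Fix a vertex v in it and list first v, then its neighbors, then the other
   vertices sorted by their adjacencies to v and its neighbors.  The J_4-free
   graphs of minimum degree at least 3 listed in this way are few enough to be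
   enumerated vertex by vertex: each is 3-colorable or is one of three graphs
   G_16, G_17, G_18 on nine vertices, with 16, 17 and 18 edges, obtained from
   one another by adding an edge.  Only G_18 is maximal J_4-free and only G_16
   is minimal, so that they are pairwise non-isomorphic. *)
Require Import Defs.
From mathcomp Require Import all_boot.

Set Implicit Arguments.
Unset Strict Implicit.
Unset Printing Implicit Defensive.

(** * Graph codes, the pruned search and the test at its leaves *)

Section Map2.
Variables (A B C : Type) (op : A -> B -> C).

Definition map2 (s : seq A) (t : seq B) := [seq op p.1 p.2 | p <- zip s t].

Lemma map2_map (T : Type) (f : T -> A) (g : T -> B) (s : seq T) :
  map2 (map f s) (map g s) = [seq op (f x) (g x) | x <- s].
Proof. by rewrite /map2 zip_map -map_comp. Qed.

End Map2.

Definition meets (s t : bitseq) := has id (map2 andb s t).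

Lemma meets_map (T : Type) (P Q : pred T) s :
  meets (map P s) (map Q s) = has (predI P Q) s.
Proof. by rewrite /meets map2_map has_map. Qed.

(* A graph is coded by its list of vertices, most recent first: each vertex is
   represented by its adjacencies to the older ones. *)
Fixpoint code (T : Type) (e : rel T) (s : seq T) : seq bitseq :=
  if s is x :: s' then map (e x) s' :: code e s' else [::].

Lemma size_code (T : Type) (e : rel T) s : size (code e s) = size s.
Proof. by elim: s => //= x s ->. Qed.

Lemma code_map (S T : Type) (h : S -> T) (e : rel T) s :
  code e (map h s) = code (relpre h e) s.
Proof. by elim: s => //= x s ->; rewrite -map_comp. Qed.

Lemma eq_in_code (T : eqType) (e e' : rel T) (s : seq T) :
  {in s &, e =2 e'} -> code e s = code e' s.
Proof.
elim: s => //= x s IHs ee'; congr (_ :: _); last first.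
  by apply: IHs => y z ys zs; apply: ee'; rewrite inE (ys, zs) orbT.
by apply/eq_in_map => y ys; apply: ee'; rewrite inE ?eqxx ?ys ?orbT.
Qed.

(** Position 0 is the most recent vertex. Each pair is stored once, in the row of its more recent
    member, whence the two symmetric cases. *)
Fixpoint decode (g : seq bitseq) (i j : nat) : bool :=
  match g, i, j with
  | r :: _, 0, j'.+1 => nth false r j'
  | r :: _, i'.+1, 0 => nth false r i'
  | _ :: g', i'.+1, j'.+1 => decode g' i' j'
  | _, _, _ => false
  end.

(* The characteristic sequence of the neighbors of the set m in the graph g. *)
Fixpoint nbrs (m : bitseq) (g : seq bitseq) : bitseq :=
  match m, g with
  | a :: m', r :: g' =>
    meets m' r :: (if a then map2 orb r (nbrs m' g') else nbrs m' g')
  | _, _ => [::]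
  end.

(* Here t and r are the adjacencies to the graph g of two more vertices x and y,
   and b is their mutual adjacency; the test fails only if there is a J_4
   through x and y, which is an edge with two common neighbors. *)
Definition pair_ok (b : bool) (t r : bitseq) (g : seq bitseq) : bool :=
  let A := map2 andb t r in
  if has id A then
    let B := nbrs A g in
    if b then [&& count id A <= 1, ~~ meets B t & ~~ meets B r]
    else ~~ meets B A
  else true.

(* The possible adjacencies to g of a new vertex, where b is its adjacency to
   the oldest vertex, degs are the degrees in g, and m more vertices are to come
   after it. *)
Fixpoint rows (m : nat) (b : bool) (g : seq bitseq) (degs : seq nat) :
    seq bitseq :=
  match g, degs with
  | r :: g', k :: ds =>
    if g' is [::] then [:: [:: b]] else
    flatten [seq
      (if pair_ok true t r g' then [:: true :: t] else [::]) ++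
      (if 2 < k + m then
         if pair_ok false t r g' then [:: false :: t] else [::]
       else [::])
      | t <- rows m b g' ds]
  | _, _ => [::]
  end.

Fixpoint lexle (s t : bitseq) : bool :=
  match s, t with
  | a :: s', b :: t' =>
    if a then (if b then lexle s' t' else false)
    else if b then true else lexle s' t'
  | _, _ => true
  end.

(* The oldest vertex has d neighbors, which come next; the vertices after them
   are sorted by their adjacencies to these d + 1 vertices. *)
Definition row_sorted (d : nat) (g : seq bitseq) (t : bitseq) : bool :=
  if g is r :: _ then
    if d.+1 < size g then
      lexle (drop (size r - d.+1) r) (drop (size t - d.+1) t)
    else true
  else true.

(* The nested conditionals prune the recursive calls; under vm_compute, a
   boolean connective would evaluate both of its arguments. *)
Fixpoint search (Q : pred (seq bitseq)) (d m : nat) (g : seq bitseq)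
    (degs : seq nat) : bool :=
  if m is m'.+1 then
    all (fun t =>
      if 2 < count id t + m' then
        if row_sorted d g t then
          search Q d m' (t :: g)
            (count id t :: map2 addn (map nat_of_bool t) degs)
        else true
      else true) (rows m' (size g <= d) g degs)
  else Q g.

(* As lists, for each vertex of g, the colors still allowed there. *)
Fixpoint list_colorable (g : seq bitseq) (As : seq (seq nat)) : bool :=
  match g, As with
  | r :: g', a :: l =>
    has (fun k => list_colorable g'
      (map2 (fun b c : _ => if b : bool then filter (predC1 k) c else c) r l)) a
  | _, _ => true
  end.

Definition colorable g := list_colorable g [seq iota 0 3 | _ <- g].

Fixpoint embeddings (e : rel nat) (n : nat) (g : seq bitseq) : seq (seq nat) :=
  if g is r :: g' then
    [seq p.2 :: p.1 | p <- [seq (s, x) | s <- embeddings e n g', x <- iota 0 n]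
                    & (p.2 \notin p.1) && (map (e p.2) p.1 == r)]
  else [:: [::]].

Definition edge_rel (E : seq (nat * nat)) : rel nat :=
  fun x y => (x != y) && (((x, y) \in E) || ((y, x) \in E)).

Definition min_edges : seq (nat * nat) :=
  [:: (0, 1); (0, 2); (0, 3); (0, 4); (1, 4); (1, 5); (1, 6); (2, 5); (2, 7);
      (3, 6); (3, 8); (4, 7); (4, 8); (5, 8); (6, 7); (7, 8)].
(** The graphs [G_16], [G_17] and [G_18] in this order, so that index 0 is the minimal one and index
    2 the maximal one. *)
Definition extremal_edges :=
  [:: min_edges; (2, 6) :: min_edges; [:: (2, 6), (3, 5) & min_edges] ].

(** On at most nine vertices, containing an induced copy of a nine-vertex graph means being
    isomorphic to it. *)
Definition leaf_ok (g : seq bitseq) : bool :=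
  if colorable g then true else
  has (fun E => embeddings (decode g) (size g) (code (edge_rel E) (iota 0 9))
                != [::]) extremal_edges.


(** * Soundness of the search on codes of symmetric irreflexive relations *)

Section Relation.
Variables (T : eqType) (e : rel T).
Hypotheses (e_sym : symmetric e) (e_irr : irreflexive e).

Lemma decode_code x0 s i j : i < size s -> j < size s ->
  decode (code e s) i j = e (nth x0 s i) (nth x0 s j).
Proof.
elim: s i j => [|x s IHs] [|i] [|j] //=; rewrite ?e_irr ?ltnS => ltis ltjs.
- by rewrite (nth_map x0).
- by rewrite (nth_map x0) // e_sym.
- exact: IHs.
Qed.

Lemma nbrs_code (P : pred T) s :
  nbrs (map P s) (code e s) = [seq has (fun z => P z && e z w) s | w <- s].
Proof.
elim: s => //= x s IHs; rewrite meets_map e_irr andbF IHs; congr (_ :: _).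
  by apply: eq_has => z; rewrite /= e_sym.
by case: (P x); rewrite ?map2_map.
Qed.

Lemma gt1_count (P : pred T) s : uniq s -> 1 < count P s ->
  exists x y, [/\ x \in s, y \in s, x != y, P x & P y].
Proof.
rewrite -size_filter => /(filter_uniq P).
case Ds: (filter P s) => [|x [|y t]] //= /andP[/norP[xy _] _] _.
have /andP[[/andP[Px xs]] /andP[Py ys]] :
    (P x && (x \in s)) && (P y && (y \in s)).
  by rewrite -!mem_filter Ds !inE !eqxx orbT.
by exists x, y.
Qed.

Section NoJ4.

(* J_4 consists of the edge {c, d} and its two common neighbors a and b. *)
Hypothesis noJ4 : forall a b c d, a != b ->
  [&& e c d, e a c, e a d, e b c & e b d] -> False.

(** Let z be a common neighbor of x and y. If x and y are adjacent, a second common neighbor gives a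
    [J_4] around the edge xy, and a common neighbor w of x and z in s gives one around xz, with y
    and w on its sides. Otherwise, an edge zw between common neighbors gives one around zw. *)
Lemma pair_ok_code s x y : uniq [:: x, y & s] ->
  pair_ok (e x y) (map (e x) s) (map (e y) s) (code e s).
Proof.
rewrite /= inE negb_or => /and3P[/andP[xy xs] ys Us].
rewrite /pair_ok map2_map nbrs_code; case: ifP => // _.
have neq_s u v : u \notin s -> v \in s -> u != v.
  by move=> us vs; apply: contraNneq us => ->.
case: ifP => exy.
  apply/and3P; split.
  - rewrite leqNgt count_map; apply/negP => /(gt1_count Us)[z [w]].
    case=> _ _ zw /= /andP[xz yz] /andP[xw yw].
    apply: (noJ4 zw (c := x) (d := y)).
    by rewrite exy !(e_sym _ x) !(e_sym _ y) xz yz xw yw.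
  - rewrite meets_map; apply/hasP => -[w ws] /= /andP[/hasP[z zs]].
    case/andP=> /andP[xz yz] zw xw.
    apply: (noJ4 (neq_s _ _ ys ws) (c := x) (d := z)).
    by rewrite xz yz (e_sym y) exy !(e_sym w) xw zw.
  - rewrite meets_map; apply/hasP => -[w ws] /= /andP[/hasP[z zs]].
    case/andP=> /andP[xz yz] zw yw.
    apply: (noJ4 (neq_s _ _ xs ws) (c := y) (d := z)).
    by rewrite xz yz exy !(e_sym w) yw zw.
rewrite meets_map; apply/hasP => -[w ws] /= /andP[/hasP[z zs]].
case/andP=> /andP[xz yz] zw /andP[xw yw].
by apply: (noJ4 xy (c := z) (d := w)); rewrite zw xz xw yz yw.
Qed.

(** The true row of x survives the pruning: each older y is tested against the vertices older than
    itself, and y may be a non-neighbor of x only if its degree [D y] so far can still reach 3. *)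
Lemma mem_rows m (D : T -> nat) s x : s != [::] -> uniq (x :: s) ->
    {in s, forall y, e x y || (2 < D y + m)} ->
  map (e x) s \in rows m (e x (last x s)) (code e s) (map D s).
Proof.
elim: s => // y [|z s] IHs _ Uxs Ds; first by rewrite /= inE.
set t := z :: s in IHs Uxs Ds *.
have ->: rows m (e x (last x (y :: t))) (code e (y :: t)) (map D (y :: t)) =
  flatten [seq
      (if pair_ok true r (map (e y) t) (code e t) then [:: true :: r]
       else [::]) ++
      (if 2 < D y + m then
         if pair_ok false r (map (e y) t) (code e t) then [:: false :: r]
         else [::]
       else [::])
      | r <- rows m (e x (last x t)) (code e t) (map D t)] by [].
apply/flatten_mapP; exists (map (e x) t).
  apply: IHs => // [|u ut]; last by apply: Ds; rewrite inE ut orbT.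
  by move: Uxs; rewrite /= !inE !negb_or => /andP[/andP[_ ->] /andP[_ ->]].
have := pair_ok_code Uxs; have := Ds y (mem_head _ _).
rewrite [map _ (y :: t)]/=; case: (e x y) => /= [_ -> | -> ->].
  by rewrite mem_head.
by rewrite mem_cat mem_head orbT.
Qed.

(** The normalization assumed by [search], with the oldest vertex last. Since [size s'] counts the
    oldest vertex too, exactly the next d vertices are its neighbors. *)
Fixpoint well_ordered (d : nat) (s : seq T) : bool :=
  if s is x :: s' then
    [&& well_ordered d s', (s' == [::]) || (e x (last x s') == (size s' <= d))
      & row_sorted d (code e s') (map (e x) s')]
  else true.

Lemma well_ordered_catrev d p s :
  well_ordered d (catrev p s) -> well_ordered d s.
Proof. by elim: p s => //= x p IHp s /IHp /= /and3P[]. Qed.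

(** By induction on the vertices p still to be added, the branch that follows their true rows is
    never cut. *)
Lemma search_code Q d m p s :
    size p = m -> s != [::] -> uniq (catrev p s) ->
    well_ordered d (catrev p s) ->
    {in catrev p s, forall y, 2 < count (e y) (catrev p s)} ->
    search Q d m (code e s) [seq count (e y) s | y <- s] ->
  Q (code e (catrev p s)).
Proof.
elim: p m s => [|x p IHp] [|m] //= s [sz_p] s_n0 Ups ord_ps degP.
have Uxs: uniq (x :: s) by move: Ups; rewrite catrevE cat_uniq => /and3P[].
(* The m vertices still to come add at most m to the degree of y, which ends above 2. *)
have deg y : y \in x :: s -> 2 < count (e y) (x :: s) + m.
  move=> ys; have: y \in catrev p (x :: s).
    by rewrite catrevE mem_cat ys orbT.
  move/degP; rewrite catrevE count_cat -sz_p -(size_rev p) addnC => h.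
  by apply: leq_trans h _; rewrite leq_add2l count_size.
have /= /and3P[_ ] := well_ordered_catrev ord_ps.
rewrite (negPf s_n0) /= size_code => /eqP <- sortx /allP/(_ (map (e x) s)) IH.
have: search Q d m (map (e x) s :: code e s)
    (count (e x) s :: map2 addn (map nat_of_bool (map (e x) s))
       [seq count (e y) s | y <- s]).
  have := deg x (mem_head x s); rewrite /= e_irr => degx.
  move: IH; rewrite count_map degx sortx; apply.
  apply: mem_rows => // y ys; have := deg y; rewrite inE ys orbT => /(_ isT) /=.
  by rewrite (e_sym y); case: (e x y).
suff ->: count (e x) s :: map2 addn (map nat_of_bool (map (e x) s))
          [seq count (e y) s | y <- s] =
         [seq count (e y) (x :: s) | y <- x :: s].
  by apply: (IHp m (x :: s)).
rewrite -map_comp map2_map /= e_irr; congr (_ :: _).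
by apply: eq_map => y /=; rewrite (e_sym y).
Qed.

End NoJ4.

(** * Colorability of codes *)

(** Once the first vertex gets color k, deleting k from the lists of its neighbors leaves an
    independent list coloring problem on the tail. *)
Lemma list_colorableP (A : T -> seq nat) s : uniq s ->
  reflect (exists2 f : T -> nat, {in s, forall x, f x \in A x}
             & {in s &, forall x y, e x y -> f x != f y})
          (list_colorable (code e s) (map A s)).
Proof.
elim: s A => [|x s IHs] A /=; first by move=> _; left; exists (fun=> 0).
case/andP=> xs Us; apply: (iffP hasP) => [[k kA] | [f fA f_col]].
  rewrite map2_map => /IHs[//|f fA f_col].
  have fs y : y \in s -> f y \in A y /\ (e x y -> f y != k).
    move=> /fA; case: (e x y) => [|//]; by rewrite mem_filter => /andP[].
  have xE y : y \in s -> (y == x) = false.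
    by move=> ys; apply: contraNF xs => /eqP <-.
  exists (fun y => if y == x then k else f y) => [y | y z] /=.
    by rewrite inE; case: eqP => [-> // | _ /= /fs[]].
  rewrite !inE; case: eqP => [-> | _] /=; case: eqP => [-> | _] //=.
  - by rewrite e_irr.
  - by move=> _ zs /(proj2 (fs z zs)); rewrite eq_sym.
  - by move=> ys _; rewrite e_sym => /(proj2 (fs y ys)).
  by move=> ys zs; apply: f_col.
have sx y : y \in s -> y \in x :: s by rewrite inE orbC => ->.
exists (f x); first by apply: fA; rewrite mem_head.
rewrite map2_map; apply/IHs => //; exists f => [y ys | y z ys zs]; last first.
  by apply: f_col; apply: sx.
case: ifP => exy; last by apply/fA/sx.
rewrite mem_filter fA ?sx // andbT /= eq_sym.
by apply: f_col; rewrite ?mem_head ?sx.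
Qed.

Lemma colorableP s : uniq s ->
  reflect (exists2 f : T -> nat, {in s, forall x, f x < 3}
             & {in s &, forall x y, e x y -> f x != f y})
          (colorable (code e s)).
Proof.
move=> Us; rewrite /colorable.
have ->: [seq iota 0 3 | _ <- code e s] = [seq iota 0 3 | _ <- s].
  by elim: (s) => //= x s' ->.
apply: (iffP (list_colorableP _ Us)) => -[f f3 f_col]; exists f => //.
  by move=> x /f3; rewrite mem_iota.
by move=> x /f3; rewrite mem_iota.
Qed.

Lemma sub_colorable s t : uniq s -> uniq t -> {subset t <= s} ->
  colorable (code e s) -> colorable (code e t).
Proof.
move=> Us Ut st /(colorableP Us)[f f3 f_col]; apply/colorableP => //.
by exists f => [x /st/f3 | x y /st xs /st ys] //; apply: f_col.
Qed.

(** At most two neighbors leave one of the three colors free for x. *)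
Lemma colorable_rem s x : uniq s -> x \in s -> count (e x) s < 3 ->
  colorable (code e (rem x s)) -> colorable (code e s).
Proof.
move=> Us xs degx /(colorableP (rem_uniq _ Us))[f f3 f_col].
have [k k3 fk]: exists2 k, k < 3 & k \notin [seq f y | y <- s & e x y].
  have: ~~ all (mem [seq f y | y <- s & e x y]) (iota 0 3).
    apply: contraL degx => /allP/(uniq_leq_size (iota_uniq 0 3)).
    by rewrite size_map size_filter -leqNgt.
  by rewrite -has_predC => /hasP[k]; rewrite mem_iota => k3 fk; exists k.
have fkP y : y \in s -> e x y -> f y != k.
  move=> ys exy; apply: contraNneq fk => <-.
  by apply: map_f; rewrite mem_filter exy.
have remP y : y \in s -> y != x -> y \in rem x s.
  by move=> ys yx; rewrite mem_rem_uniq // inE yx.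
apply/colorableP => //; exists (fun y => if y == x then k else f y).
  by move=> y ys; case: eqP => // /eqP yx; apply/f3/remP.
move=> y z ys zs.
case: (eqVneq y x) => [-> | yx]; case: (eqVneq z x) => [-> | zx].
- by rewrite e_irr.
- by rewrite eq_sym; apply: fkP.
- by rewrite e_sym; apply: fkP.
by apply: f_col; apply: remP.
Qed.

End Relation.

(** * The sorted listing and the outcome of the search *)

Lemma lexle_total : total lexle.
Proof. by elim=> [|[] s IHs] [|[] t] //=. Qed.

(** The last [size N + 1] entries of a row are the adjacencies to [rcons N v], which [row_sorted]
    compares. The order on M is reversed because recent vertices come first. *)
Lemma well_ordered_cat (T : eqType) (e : rel T) v (M N : seq T) :
    {in N, forall x, e x v} -> {in M, forall x, ~~ e x v} ->
    sorted (fun x y => lexle (map (e y) (rcons N v)) (map (e x) (rcons N v)))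
      M ->
  well_ordered e (size N) (M ++ rcons N v).
Proof.
move=> eN; elim: M => [_ _ |x M IHM eM sortM] /=.
  (* The bound d must stay fixed while the induction shortens N. *)
  set d := size N; have: size N <= d by [].
  elim: (N) eN => //= x N' IHN eN le_d.
  have ex: e x v by apply: eN; rewrite mem_head.
  apply/and3P; split.
  - by apply: IHN; [move=> y ys; apply: eN; rewrite inE ys orbT | apply: ltnW].
  - by rewrite last_rcons ex size_rcons le_d orbT.
  rewrite /row_sorted size_code size_rcons.
  by case: (code e _) => // r g; rewrite ltnS ltnNge ltnW.
apply/and3P; split.
- by apply: IHM (path_sorted sortM) => y ys; apply: eM; rewrite inE ys orbT.
- rewrite last_cat last_rcons (negPf (eM x (mem_head _ _))) size_cat size_rcons.
  by rewrite addnS leqNgt ltnS leq_addl orbT.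
rewrite /row_sorted size_code.
case: M sortM {IHM eM} => [_|y M] /=.
  by case: code => // r g; rewrite size_rcons ltnn.
case/andP=> xy _; rewrite !size_map !size_cat size_rcons addnS !ltnS leq_addl.
by rewrite !subSS -addSn !addnK /= !map_cat !drop_size_cat ?size_map.
Qed.

Lemma embeddingsP e n g p :
  p \in embeddings e n g -> [/\ uniq p, {in p, forall i, i < n} & code e p = g].
Proof.
elim: g p => [|r g IHg] p /=; first by rewrite inE => /eqP->.
case/mapP=> -[s x]; rewrite mem_filter /= => /andP[/andP[xs /eqP xr]].
case/allpairsP=> -[s' x'] /= [/IHg[Us ltsn gE]].
rewrite mem_iota => ltxn [Es Ex] ->; rewrite /= xs xr Es Us gE; split=> //.
by move=> i; rewrite inE Ex => /predU1P[-> | /ltsn].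
Qed.

(** Here n is the number of vertices after the oldest one and d, from 3 to 8, is its degree; [[::
    [::]]] codes the one-vertex graph. *)
Lemma search_leaf_ok :
  all (fun n => all (fun d => search leaf_ok d n [:: [::]] [:: 0]) (iota 3 6))
      (iota 0 9).
Proof. by vm_compute. Qed.

(** * [J_4]-freeness and arrowing as boolean tests *)

Lemma has_J4 (G : sgraph) (a b c d : G) : a != b ->
  [&& adj c d, adj a c, adj a d, adj b c & adj b d] -> has_subgraph (J 4) G.
Proof.
move=> ab /and5P[cd ac ad bc bd].
have neq (x y : G): adj x y -> x != y.
  by apply: contraTneq => ->; rewrite adj_irr.
(* The missing edge of [J 4] joins 0 and 1, so a and b come first. *)
exists (fun i : J 4 => nth a [:: a; b; c; d] i).
  have Uabcd: uniq [:: a; b; c; d].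
    by rewrite /= !inE !negb_or ab !neq.
  by move=> i j /eqP; rewrite nth_uniq ?ltn_ord // => /eqP/val_inj.
by move=> [[|[|[|[|i]]]] lti] [[|[|[|[|j]]]] ltj] //= _; rewrite // adj_sym.
Qed.

Definition J4b (T : Type) (e : rel T) (s : seq T) : bool :=
  has (fun c => has (fun d =>
    if e c d then 1 < count (fun a => e a c && e a d) s else false) s) s.

Lemma J4P (G : sgraph) :
  reflect (has_subgraph (J 4) G) (J4b (@adj G) (enum G)).
Proof.
apply: (iffP hasP) => [[c _ /hasP[d _]] | [f inj_f f_adj]].
  case: ifP => // cd /(gt1_count (enum_uniq G))[a [b [_ _ ab]]].
  case/andP=> ac ad /andP[bc bd].
  by apply: (has_J4 ab (c := c) (d := d)); apply/and5P.
pose a : J 4 := @Ordinal 4 0 isT; pose b : J 4 := @Ordinal 4 1 isT.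
pose c : J 4 := @Ordinal 4 2 isT; pose d : J 4 := @Ordinal 4 3 isT.
exists (f c); first by rewrite mem_enum.
apply/hasP; exists (f d); rewrite ?mem_enum // f_adj // -size_filter.
have: {subset [:: f a; f b] <= [seq x <- enum G | adj x (f c) && adj x (f d)]}.
  move=> x; rewrite mem_filter mem_enum andbT !inE.
  by case/orP=> /eqP->; rewrite !f_adj.
by apply: uniq_leq_size; rewrite /= inE (inj_eq inj_f).
Qed.

Lemma arrows222P (G : sgraph) :
  reflect (arrows G [tuple 2; 2; 2]) (~~ colorable (code (@adj G) (enum G))).
Proof.
have colP := colorableP (@adj_sym G) (@adj_irr G) (enum_uniq G).
have tnth2 i : tnth [tuple 2; 2; 2] i = 2.
  by rewrite (tnth_nth 0); case: i => [[|[|[|]]]].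
apply: (iffP idP) => [ncol c | arrG]; last first.
  apply/colP => -[f f3 f_col].
  have [i [K [clK /eqP]]] := arrG (fun x => inord (f x)).
  rewrite tnth2 => /cards2P[x [y [xy defK]]] ci.
  have xK: x \in K by rewrite defK !inE eqxx.
  have yK: y \in K by rewrite defK !inE eqxx orbT.
  have /eqP[] := f_col x y (mem_enum _ _) (mem_enum _ _) (clK x y xK yK xy).
  rewrite -(inordK (f3 x _)) ?mem_enum // (ci x) // -(ci y) //.
  by rewrite inordK ?f3 ?mem_enum.
have [/existsP[x /existsP[y /andP[xy /eqP cxy]]] | no_mono] :=
    boolP [exists x, exists y, adj x y && (c x == c y)].
  exists (c x), [set x; y]; split.
  - move=> u v; rewrite !inE => /orP[]/eqP-> /orP[]/eqP-> //; rewrite ?eqxx //.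
    by rewrite adj_sym.
  - rewrite tnth2 cards2; case: eqP xy => // ->; by rewrite adj_irr.
  by move=> u; rewrite !inE => /orP[]/eqP->.
case/colP: ncol; exists c => [x _ | x y _ _ xy]; first exact: ltn_ord.
move: no_mono; rewrite negb_exists => /forallP/(_ x).
by rewrite negb_exists => /forallP/(_ y); rewrite xy.
Qed.

(** * Invariance under isomorphism *)

Section Isomorphism.
Variables G H : sgraph.

Lemma giso_sym : giso G H -> giso H G.
Proof.
case=> f [g fK gK] f_adj; exists g; first by exists f.
by move=> x y; rewrite -f_adj !gK.
Qed.

Lemma giso_card : giso G H -> #|G| = #|H|.
Proof. by case=> f bij_f _; apply: bij_eq_card bij_f. Qed.

Lemma giso_has_subgraph K : giso G H -> has_subgraph K G -> has_subgraph K H.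
Proof.
case=> f bij_f f_adj [h inj_h h_adj]; exists (f \o h).
  exact: inj_comp (bij_inj bij_f) inj_h.
by move=> x y /h_adj; rewrite /= f_adj.
Qed.

Lemma giso_arrows r (a : r.-tuple nat) : giso G H -> arrows G a -> arrows H a.
Proof.
case=> f bij_f f_adj arrG c; have [i [K [clK cardK cK]]] := arrG (c \o f).
exists i, (f @: K); split.
- move=> _ _ /imsetP[x xK ->] /imsetP[y yK ->].
  by rewrite (bij_eq bij_f) f_adj; apply: clK.
- by rewrite card_imset //; apply: bij_inj bij_f.
by move=> _ /imsetP[x xK ->]; apply: cK.
Qed.

End Isomorphism.

Lemma eq_set2 (T : finType) (u v x y : T) :
  ([set u; v] == [set x; y]) =
    (u == x) && (v == y) || (u == y) && (v == x).
Proof.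
apply/eqP/idP => [E | /orP[]/andP[/eqP-> /eqP->] //]; last exact: setUC.
have := (set21 u v, set22 u v); rewrite E !inE => -[].
have := (set21 x y, set22 x y); rewrite -E !inE !(eq_sym x) !(eq_sym y) => -[].
by do 4!case: eqP => //= _.
Qed.

Lemma giso_add_edge (G H : sgraph) (f : G -> H) (x y : G) : bijective f ->
    (forall u v, adj (f u) (f v) = adj u v) ->
  giso (add_edge x y) (add_edge (f x) (f y)).
Proof.
move=> bij_f f_adj; exists f => // u v.
by rewrite /= /add_adj f_adj !eq_set2 !(bij_eq bij_f).
Qed.

Lemma giso_del_edge (G H : sgraph) (f : G -> H) (x y : G) : bijective f ->
    (forall u v, adj (f u) (f v) = adj u v) ->
  giso (del_edge x y) (del_edge (f x) (f y)).
Proof.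
move=> bij_f f_adj; exists f => // u v.
by rewrite /= /del_adj f_adj !eq_set2 !(bij_eq bij_f).
Qed.

Lemma giso_maximal_free (K G H : sgraph) :
  giso G H -> maximal_free K G -> maximal_free K H.
Proof.
move=> isoGH [freeG maxG]; split.
  by move=> subH; apply/freeG/(giso_has_subgraph (giso_sym isoGH)).
case: isoGH => f bij_f f_adj x y.
have [g fK gK] := bij_f; rewrite -[x]gK -[y]gK (bij_eq bij_f) f_adj => xy nxy.
exact: giso_has_subgraph (giso_add_edge _ _ bij_f f_adj) (maxG _ _ xy nxy).
Qed.

Lemma giso_minimal_arrowing r (a : r.-tuple nat) (G H : sgraph) :
  giso G H -> minimal_arrowing a G -> minimal_arrowing a H.
Proof.
move=> isoGH [arrG minG]; split; first exact: giso_arrows isoGH arrG.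
case: isoGH => f bij_f f_adj x y.
have [g fK gK] := bij_f; rewrite -[x]gK -[y]gK f_adj => xy arrH.
apply: (minG _ _ xy); apply: giso_arrows arrH.
exact/giso_sym/giso_del_edge.
Qed.

(** * Graphs given by edge lists on nine vertices *)

Lemma edge_rel_sym E : symmetric (edge_rel E).
Proof. by move=> x y; rewrite /edge_rel eq_sym orbC. Qed.

Lemma edge_rel_irr E : irreflexive (edge_rel E).
Proof. by move=> x; rewrite /edge_rel eqxx. Qed.

(** The adjacency comes from a relation on numbers, so that every test can be computed on
    [iota 0 9]. *)
Definition edge_graph (E : seq (nat * nat)) : sgraph :=
  @SGraph 'I_9 (relpre val (edge_rel E))
    (fun x y => edge_rel_sym E x y) (fun x => edge_rel_irr E x).

Lemma code_edge_graph E :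
  code (@adj (edge_graph E)) (enum (edge_graph E)) =
  code (edge_rel E) (iota 0 9).
Proof. by rewrite -val_enum_ord code_map. Qed.

Lemma edge_graph_J4P E :
  reflect (has_subgraph (J 4) (edge_graph E)) (J4b (edge_rel E) (iota 0 9)).
Proof.
rewrite -val_enum_ord (_ : J4b _ _ = J4b (@adj (edge_graph E)) (enum 'I_9)).
  exact: J4P.
rewrite /J4b has_map; apply: eq_has => x /=; rewrite has_map.
by apply: eq_has => y /=; rewrite count_map.
Qed.

Lemma edge_graph_arrowsP E :
  reflect (arrows (edge_graph E) [tuple 2; 2; 2])
          (~~ colorable (code (edge_rel E) (iota 0 9))).
Proof. by rewrite -code_edge_graph; apply: arrows222P. Qed.

Lemma add_edge_edge_graph E (x y : edge_graph E) :
  giso (add_edge x y) (edge_graph ((val x, val y) :: E)).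
Proof.
exists id => [|u v]; first by exists id.
rewrite /= /add_adj eq_set2 /= /edge_rel !inE !xpair_eqE -!(inj_eq val_inj) /=.
by do 5!case: eqP => _; do 2!case: (_ \in _).
Qed.

Definition remove_edge (x y : nat) (E : seq (nat * nat)) :=
  [seq p <- E | (p != (x, y)) && (p != (y, x))].

Lemma del_edge_edge_graph E (x y : edge_graph E) :
  giso (del_edge x y) (edge_graph (remove_edge (val x) (val y) E)).
Proof.
exists id => [|u v]; first by exists id.
rewrite /= /del_adj eq_set2 /= /edge_rel !mem_filter !xpair_eqE.
rewrite -!(inj_eq val_inj) /=.
by do 5!case: eqP => _; do 2!case: (_ \in _).
Qed.

Lemma all_ordP n (P : pred nat) :
  reflect (forall i : 'I_n, P i) (all P (iota 0 n)).
Proof.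
rewrite -val_enum_ord all_map.
by apply: (iffP allP) => [h i | h i _]; apply: h; rewrite ?mem_enum.
Qed.

Definition maximal_edges E := ~~ J4b (edge_rel E) (iota 0 9) &&
  all (fun x => all (fun y => [|| x == y, edge_rel E x y
                              | J4b (edge_rel ((x, y) :: E)) (iota 0 9)])
    (iota 0 9)) (iota 0 9).

Lemma maximal_edgesP E :
  reflect (maximal_free (J 4) (edge_graph E)) (maximal_edges E).
Proof.
apply: (iffP andP) => -[noJ4 maxE]; split; try by apply/edge_graph_J4P.
- move=> x y xy nxy; move/all_ordP/(_ x)/all_ordP/(_ y): maxE.
  rewrite (negPf xy : (x == y :> nat) = false).
  rewrite (negPf nxy : edge_rel E x y = false).
  move/edge_graph_J4P.
  exact: giso_has_subgraph (giso_sym (add_edge_edge_graph x y)).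
- apply/all_ordP => x; apply/all_ordP => y.
  have := maxE x y; rewrite -(inj_eq val_inj) /=.
  case: eqP => //= _; case: edge_rel => //= /(_ isT isT).
  move/(giso_has_subgraph (add_edge_edge_graph x y)).
  by move/edge_graph_J4P.
Qed.

Definition minimal_edges E := ~~ colorable (code (edge_rel E) (iota 0 9)) &&
  all (fun x => all (fun y => edge_rel E x y ==>
         colorable (code (edge_rel (remove_edge x y E)) (iota 0 9)))
    (iota 0 9)) (iota 0 9).

Lemma minimal_edgesP E :
  reflect (minimal_arrowing [tuple 2; 2; 2] (edge_graph E)) (minimal_edges E).
Proof.
apply: (iffP andP) => -[arrE minE]; split; try by apply/edge_graph_arrowsP.
- move=> x y xy; move/all_ordP/(_ x)/all_ordP/(_ y): minE.
  rewrite (xy : edge_rel E x y) /= => col.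
  move/(giso_arrows (del_edge_edge_graph x y)).
  by apply/edge_graph_arrowsP; rewrite col.
- apply/all_ordP => x; apply/all_ordP => y; apply/implyP => xy.
  apply: contra_notT (minE x y xy) => /edge_graph_arrowsP.
  exact: giso_arrows (giso_sym (del_edge_edge_graph x y)).
Qed.

(** * From an arbitrary graph to the search *)

Lemma minimal_noncolorable (G : sgraph) :
    ~~ colorable (code (@adj G) (enum G)) ->
  exists s : seq G, [/\ uniq s, ~~ colorable (code (@adj G) s)
    & {in s, forall x, 2 < count (adj x) s}].
Proof.
set col := fun s => colorable (code (@adj G) s) => ncolG.
(* Tuples of a fixed size form a finite type, which makes [P] boolean, as [ex_minnP] requires. *)
pose P n := [exists s : n.-tuple G, uniq s && ~~ col s].
have exP: exists n, P n.
  exists (size (enum G)); apply/existsP; exists (in_tuple (enum G)).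
  by rewrite enum_uniq.
have [n /existsP[[s /= sz_s] /andP[/= Us ncol_s]] min_n] := ex_minnP exP.
exists s; split=> // x xs; rewrite ltnNge; apply: contra ncol_s => deg_x.
apply: (colorable_rem (@adj_sym G) (@adj_irr G) Us xs deg_x).
apply: contraT => ncol; suff /min_n: P (size (rem x s)).
  by rewrite size_rem // -(eqP sz_s); case: (s) xs => // y s' _; rewrite ltnn.
by apply/existsP; exists (in_tuple (rem x s)); rewrite rem_uniq.
Qed.

(** The code has nine rows, so s exhausts G, and a vertex is sent to its position in s. *)
Lemma giso_edge_graph (G : sgraph) E (s : seq G) : uniq s -> #|G| <= 9 ->
    code (@adj G) s = code (edge_rel E) (iota 0 9) ->
  giso G (edge_graph E).
Proof.
move=> Us G9 codeE.
have sz_s: size s = 9 by rewrite -(size_code (@adj G)) codeE.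
have mem_s x : x \in s.
  have [] := uniq_min_size Us (fun y _ => mem_enum G y : y \in enum G).
    by rewrite -cardE sz_s.
  by move=> _ ->; rewrite mem_enum.
have lt9 x : index x s < 9 by rewrite -sz_s index_mem.
exists (fun x => Ordinal (lt9 x)).
  have v0 : G by case: (s) sz_s.
  exists (fun i : 'I_9 => nth v0 s i) => [x | i] /=; first exact: nth_index.
  by apply: val_inj; rewrite /= index_uniq ?sz_s.
move=> x y; have nthK := fun z => nth_index x (mem_s z).
rewrite /= -[RHS](congr2 (@adj G) (nthK x) (nthK y)).
rewrite -decode_code ?index_mem //; [|exact: adj_sym | exact: adj_irr].
rewrite codeE (decode_code (edge_rel_sym E) (edge_rel_irr E) 0) ?size_iota //.
by rewrite !nth_iota.
Qed.

Lemma extremal_classification (G : sgraph) :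
    folkman_graph [tuple 2; 2; 2] (J 4) G -> #|G| <= 9 ->
  exists2 E, E \in extremal_edges & giso G (edge_graph E).
Proof.
case=> freeG /arrows222P/minimal_noncolorable[s [Us ncol_s deg_s]] G9.
have [aS aI] := (@adj_sym G, @adj_irr G).
case Ds: s => [|v s']; first by rewrite Ds in ncol_s.
have vs: v \in s by rewrite Ds mem_head.
pose N := [seq x <- s | adj x v].
pose key x := map (adj x) (rcons N v).
pose M := sort (fun x y => lexle (key y) (key x))
            [seq x <- s | ~~ adj x v & x != v].
pose L := M ++ rcons N v.
have Ls: perm_eq L s.
  rewrite /L; apply: uniq_perm => // [|x].
    rewrite cat_uniq sort_uniq rcons_uniq !filter_uniq // mem_filter aI /=.
    rewrite andbT.
    apply/hasPn => x; rewrite mem_rcons inE mem_sort !mem_filter.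
    by case/predU1P=> [-> | /andP[-> _]]; rewrite ?eqxx ?andbF.
  rewrite mem_cat mem_rcons inE mem_sort !mem_filter.
  by case: eqVneq => [-> | _]; case: adj; case: (x \in s) vs.
have UL: uniq L by rewrite (perm_uniq Ls).
have degL: {in L, forall x, 2 < count (adj x) L}.
  by move=> x; rewrite (perm_mem Ls) (permP Ls) => /deg_s.
have ordL: well_ordered (@adj G) (size N) L.
  apply: well_ordered_cat => [x | x |].
  - by rewrite mem_filter => /andP[].
  - by rewrite mem_sort mem_filter => /andP[/andP[]].
  by apply: sort_sorted => x y; apply: lexle_total.
have sizeN: 2 < size N.
  by rewrite size_filter -(eq_count (fun x => aS v x)); apply: deg_s.
(* The search starts from v alone and adds the vertices of p in order. *)
have [p Lp]: exists p, L = catrev p [:: v].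
  by exists (rev (M ++ N)); rewrite catrevE revK /L cats1 -rcons_cat.
have sizeL: size L <= 9.
  by apply: leq_trans G9; rewrite -(card_uniqP UL) max_card.
have sizeLp: size L = (size p).+1 by rewrite Lp catrevE size_cat size_rev addn1.
have ltNp: size N < 9.
  by apply: leq_trans sizeL; rewrite /L size_cat size_rcons leq_addl.
have : leaf_ok (code (@adj G) L).
  rewrite Lp in UL ordL degL *.
  apply: (search_code aS aI _ (erefl (size p))) UL ordL degL _ => //.
    by move=> a b c d ab /(has_J4 ab)/freeG.
  have p9: size p \in iota 0 9 by rewrite mem_iota -sizeLp.
  have ->: [seq count (adj y) [:: v] | y <- [:: v]] = [:: 0] by rewrite /= aI.
  by apply: (allP (allP search_leaf_ok _ p9)); rewrite mem_iota sizeN.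
rewrite /leaf_ok; case: ifP => [col | _ /hasP[E extE]].
  case/negP: ncol_s; apply: sub_colorable col => // x; by rewrite (perm_mem Ls).
(* Only two occurrences of [embs] are destructed below, so that the head q of the list is still
   known to belong to [embs]. *)
set embs := embeddings _ _ _; have: {subset embs <= embs} by [].
case: {1 3}embs => // q qs /(_ q (mem_head _ _))/embeddingsP.
rewrite size_code => -[Uq q_lt codeq] _; exists E => //.
(* The positions q in L become nine distinct vertices of G with the code of E; thus L was all of
   G. *)
apply: (@giso_edge_graph G E (map (nth v L) q)) => //.
  rewrite map_inj_in_uniq // => i j /q_lt lti /q_lt ltj /eqP.
  by rewrite nth_uniq // => /eqP.
rewrite code_map -codeq; apply: eq_in_code => i j /q_lt lti /q_lt ltj.
by rewrite /= (decode_code aS aI v).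
Qed.

Theorem theorem3 :
  [/\ folkman_number_is [tuple 2; 2; 2] (J 4) 9,
      exactly_up_to_iso 3 (folkman_set [tuple 2; 2; 2] (J 4) 9),
      exactly_up_to_iso 1 (fun G : sgraph =>
        folkman_set [tuple 2; 2; 2] (J 4) 9 G /\ maximal_free (J 4) G)
    & exactly_up_to_iso 1 (fun G : sgraph =>
        folkman_set [tuple 2; 2; 2] (J 4) 9 G /\
        minimal_arrowing [tuple 2; 2; 2] G)].
Proof.
pose H (i : 'I_3) := edge_graph (nth [::] extremal_edges i).
have Hmax i : reflect (maximal_free (J 4) (H i)) (i == inord 2 :> 'I_3).
  have ->: (i == inord 2) = maximal_edges (nth [::] extremal_edges i).
    rewrite -(inj_eq val_inj) /= inordK //.
    by case: i => [[|[|[|]]]] // lti; vm_compute.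
  exact: maximal_edgesP.
have Hmin i : reflect (minimal_arrowing [tuple 2; 2; 2] (H i)) (i == ord0).
  have ->: (i == ord0) = minimal_edges (nth [::] extremal_edges i).
    by case: i => [[|[|[|]]]] // lti; vm_compute.
  exact: minimal_edgesP.
have Hset i : folkman_set [tuple 2; 2; 2] (J 4) 9 (H i).
  have: all (fun E => ~~ J4b (edge_rel E) (iota 0 9) &&
                      ~~ colorable (code (edge_rel E) (iota 0 9)))
          extremal_edges by vm_compute.
  move/allP/(_ _ (mem_nth [::] (ltn_ord i : i < size extremal_edges))).
  case/andP=> /edge_graph_J4P noJ4 /edge_graph_arrowsP arrH.
  by split; last exact: card_ord.
have classify G : folkman_graph [tuple 2; 2; 2] (J 4) G -> #|G| <= 9 ->
    exists i, giso G (H i).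
  move=> FG /(extremal_classification FG)[E /(nthP [::])[i lti <-] isoG].
  by exists (Ordinal lti).
split.
- split=> [|G FG]; first by exists (H ord0); case: (Hset ord0).
  (* A smaller graph would be isomorphic to one on nine vertices. *)
  rewrite leqNgt; apply/negP => ltG9; have [i] := classify G FG (ltnW ltG9).
  by move/giso_card => E; move: ltG9; rewrite E (proj2 (Hset i)) ltnn.
- exists H; split=> [// | i j isoij | G [FG G9]]; last first.
    by apply: classify; rewrite ?G9.
  (* Maximality singles out index 2 and minimality index 0; together these two invariants determine
     the index. *)
  have Emax: (i == inord 2) = (j == inord 2).
    apply/idP/idP => /Hmax maxH; apply/Hmax.
      exact: giso_maximal_free maxH.
    exact: giso_maximal_free (giso_sym isoij) maxH.
  have Emin: (i == ord0) = (j == ord0).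
    apply/idP/idP => /Hmin minH; apply/Hmin.
      exact: giso_minimal_arrowing minH.
    exact: giso_minimal_arrowing (giso_sym isoij) minH.
  move: Emax Emin; rewrite -!(inj_eq val_inj) /= inordK // => Emax Emin.
  apply/val_inj; move: Emax Emin.
  by case: i j {isoij} => [[|[|[|]]]] // ? [[|[|[|]]]].
- exists (fun=> H (inord 2)); split=> [i | i j _ | G [[FG G9] maxG]].
  + by split; [apply: Hset | apply/Hmax].
  + by rewrite !ord1.
  have [|i isoG] := classify G FG; first by rewrite G9.
  exists ord0; suff /Hmax/eqP <-: maximal_free (J 4) (H i) by [].
  exact: giso_maximal_free maxG.
exists (fun=> H ord0); split=> [i | i j _ | G [[FG G9] minG]].
- by split; [apply: Hset | apply/Hmin].
- by rewrite !ord1.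
have [|i isoG] := classify G FG; first by rewrite G9.
exists ord0; suff /Hmin/eqP <-: minimal_arrowing [tuple 2; 2; 2] (H i) by [].
exact: giso_minimal_arrowing minG.
Qed.
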